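(* Consider the production-destruction system $\frac{dc_i}{dt}=\sum_{j=1}^M p_{ij}(c)-\sum_{j=1}^M d_{ij}(c)$, $i=1,\dots,M$, with $p_{ij}(c)=d_{ji}(c)\ge 0$, and the modified Patankar multistep scheme $$c_i^{n+1}=\frac{11}{27}c_i^{n-3}+\frac{16}{27}c_i^n+\Delta t\sum_{j=1}^M\left(\Big(\frac49 p_{ij}(c^{n-3})+\frac{16}{9}p_{ij}(c^n)\Big)\frac{c_j^{n+1}}{\sigma_j}-\Big(\frac49 d_{ij}(c^{n-3})+\frac{16}{9}d_{ij}(c^n)\Big)\frac{c_i^{n+1}}{\sigma_i}\right),\quad i=1,\dots,M.$$ This scheme is third-order accurate with $$\sigma_i=(c_i^n)^s(c_i^{n-1})^r(c_i^{n-2})^p(c_i^{n-3})^{1-r-s-p}\qquad\text{and}\qquad r=-3s+6,\quad p=3s-8.$$ Moreover, it is conservative, which means that $$\sum_{i=1}^M c_i^{n-3}=\sum_{i=1}^M c_i^{n-2}=\sum_{i=1}^M c_i^{n-1}=\sum_{i=1}^M c_i^{n}=\sum_{i=1}^M c_i^{n+1},$$ and it is unconditionally positivity-preserving (that is, with no restriction on the time step $\Delta t>0$): if $c_i^n\ge 0$ for $i=1,2,\dots,M$, then $c_i^{n+1}\ge 0$ for $i=1,2,\dots,M$.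
   Context: Here $c=(c_1,\dots,c_M)^T$ is the vector of concentrations of the $M$ components, $c_i^m$ denotes the numerical approximation of $c_i(t^m)$ at time level $m$ on a uniform time grid with step $\Delta t$, and $c^m=(c_1^m,\dots,c_M^m)^T$. The function $p_{ij}$ is the production rate (transformation of component $j$ into component $i$) and $d_{ij}$ the destruction rate (transformation of component $i$ into component $j$). The parameters $s,r,p$ are real numbers; the exponent $p$ is unrelated to the functions $p_{ij}$. Third-order accuracy is meant in the usual sense that the local truncation error of the scheme is $O(\Delta t^4)$.
   Formalization: Conservation assumes that the four starting values have equal totals; positivity assumes c^{n-3}, ..., c^n all nonnegative, not only c^n; accuracy is for positive C^4 solutions and rates continuous at positive concentrations. *)

(* Defs.v *)
From HB Require Import structures.
From mathcomp Require Import all_boot all_order all_algebra.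
From mathcomp Require Import all_classical all_reals all_analysis.
Import Order.TTheory GRing.Theory Num.Theory.
Import numFieldNormedType.Exports.

Set Implicit Arguments.
Unset Strict Implicit.
Unset Printing Implicit Defensive.

Local Open Scope classical_set_scope.
Local Open Scope ring_scope.

(* Concentration vectors are column vectors; component i of x is x i ord0.    *)

Definition nneg_vec (R : realType) (M : nat) (x : 'cV[R]_M) : Prop :=
  forall i, 0 <= x i ord0.

Definition pos_vec (R : realType) (M : nat) (x : 'cV[R]_M) : Prop :=
  forall i, 0 < x i ord0.

Definition total (R : realType) (M : nat) (x : 'cV[R]_M) : R :=
  \sum_i x i ord0.

(* Rate laws are total functions, but a law such as P i j x = x_0 * x_1 is    *)
(* nonnegative only for nonnegative concentrations, so only this is required. *)
Definition production_destruction (R : realType) (M : nat)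
    (P D : 'I_M -> 'I_M -> 'cV[R]_M -> R) : Prop :=
  (forall i j x, P i j x = D j i x) /\
  (forall i j x, nneg_vec x -> 0 <= P i j x).

(* In a sequence y of vectors, y m is the value at time level m. The index    *)
(* n - 3 is a truncated subtraction: the definitions below are only used with *)
(* 3 <= n.                                                                    *)

(* powR is total, with 0 `^ 0 = 1 and 0 `^ a = 0 for all a != 0.              *)
Definition sigma (R : realType) (M : nat) (s r p : R)
    (y : nat -> 'cV[R]_M) (n : nat) (i : 'I_M) : R :=
  y n i ord0 `^ s * y (n - 1)%N i ord0 `^ r * y (n - 2)%N i ord0 `^ p
  * y (n - 3)%N i ord0 `^ (1 - r - s - p).

(* The scheme is implicit: its right-hand side contains the level n + 1.      *)
(* Division is total, so a quotient y_j / sigma_j with sigma_j = 0 is 0.      *)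
Definition mpms_rhs (R : realType) (M : nat)
    (P D : 'I_M -> 'I_M -> 'cV[R]_M -> R) (s r p dt : R)
    (y : nat -> 'cV[R]_M) (n : nat) (i : 'I_M) : R :=
  11 / 27 * y (n - 3)%N i ord0 + 16 / 27 * y n i ord0
  + dt * \sum_j
      ((4 / 9 * P i j (y (n - 3)%N) + 16 / 9 * P i j (y n))
         * (y n.+1 j ord0 / sigma s r p y n j)
       - (4 / 9 * D i j (y (n - 3)%N) + 16 / 9 * D i j (y n))
         * (y n.+1 i ord0 / sigma s r p y n i)).

Definition mpms_step (R : realType) (M : nat)
    (P D : 'I_M -> 'I_M -> 'cV[R]_M -> R) (s r p dt : R)
    (y : nat -> 'cV[R]_M) (n : nat) : Prop :=
  forall i, y n.+1 i ord0 = mpms_rhs P D s r p dt y n i.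

Definition C4_on (R : realType) (A : set R) (f : R -> R) : Prop :=
  forall t, A t ->
    (forall k, (k < 4)%N -> derivable (derive1n k f) t 1) /\
    {for t, continuous (derive1n 4 f)}.

(* A C^4 positive solution on [t0, T]. The open interval ]a, b[ around it     *)
(* only serves to make the derivatives at t0 and T two-sided; nothing but     *)
(* smoothness is required outside [t0, T], so every solution which is C^4 up  *)
(* to the end points has an extension of this form.                           *)
Definition exact_solution (R : realType) (M : nat)
    (P D : 'I_M -> 'I_M -> 'cV[R]_M -> R) (t0 T : R)
    (c : R -> 'cV[R]_M) : Prop :=
  [/\ exists a b : R, [/\ a < t0, T < b &
        forall i, C4_on `]a, b[ (fun t => c t i ord0)],
      forall t, t0 <= t <= T -> pos_vec (c t)
    & forall t, t0 <= t <= T -> forall i,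
        is_derive t (1 : R) (fun u => c u i ord0)
          (\sum_j P i j (c t) - \sum_j D i j (c t))].

Definition on_grid (R : realType) (M : nat) (c : R -> 'cV[R]_M) (t0 dt : R)
    (m : nat) : 'cV[R]_M :=
  c (t0 + m%:R * dt).

(* Two notions are in use for the local truncation error of a multistep       *)
(* scheme: the residual left by the exact solution at all levels, and the     *)
(* error after one step from exact values at the levels n - 3, ..., n. Both   *)
(* are required to be O(dt^4), uniformly in n.                                *)
Definition third_order_accurate (R : realType) (M : nat)
    (P D : 'I_M -> 'I_M -> 'cV[R]_M -> R) (s r p : R) : Prop :=
  forall (t0 T : R) (c : R -> 'cV[R]_M), exact_solution P D t0 T c ->
  exists C : R, \forall dt \near 0^'+, forall n : nat,
    (3 <= n)%N -> t0 + n.+1%:R * dt <= T ->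
    let e := on_grid c t0 dt in
    (forall i, `|e n.+1 i ord0 - mpms_rhs P D s r p dt e n i| <= C * dt ^+ 4)
    /\
    (forall y : nat -> 'cV[R]_M,
       (forall m, (n - 3 <= m <= n)%N -> y m = e m) ->
       mpms_step P D s r p dt y n ->
       forall i, `|e n.+1 i ord0 - y n.+1 i ord0| <= C * dt ^+ 4).

(* The scheme determines the levels from 4 on; the starting values y 0, ...,  *)
(* y 3 come from elsewhere and must have the same total mass themselves.      *)
Definition conservative (R : realType) (M : nat)
    (P D : 'I_M -> 'I_M -> 'cV[R]_M -> R) (s r p : R) : Prop :=
  forall (dt : R) (y : nat -> 'cV[R]_M) (N : nat), 0 < dt ->
    [/\ total (y 0%N) = total (y 1%N), total (y 1%N) = total (y 2%N)
      & total (y 2%N) = total (y 3%N)] ->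
    (forall n, (3 <= n <= N)%N -> mpms_step P D s r p dt y n) ->
    forall n, (3 <= n <= N)%N ->
      [/\ total (y (n - 3)%N) = total (y (n - 2)%N),
          total (y (n - 2)%N) = total (y (n - 1)%N),
          total (y (n - 1)%N) = total (y n)
        & total (y n) = total (y n.+1)].

Definition positivity_preserving (R : realType) (M : nat)
    (P D : 'I_M -> 'I_M -> 'cV[R]_M -> R) (s r p : R) : Prop :=
  forall (dt : R) (y : nat -> 'cV[R]_M) (n : nat), 0 < dt -> (3 <= n)%N ->
    (forall m, (n - 3 <= m <= n)%N -> nneg_vec (y m)) ->
    mpms_step P D s r p dt y n ->
    nneg_vec (y n.+1).

(* Main.v *)
Require Import Defs.
From HB Require Import structures.
From mathcomp Require Import all_boot all_order all_algebra.
From mathcomp Require Import all_classical all_reals all_analysis.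
From mathcomp Require Import ring lra zify.
Import Order.TTheory GRing.Theory Num.Theory.
Import numFieldNormedType.Exports.
Local Open Scope classical_set_scope.
Local Open Scope ring_scope.

(** Conservation, positivity and stability of one step all come from one linear
    fact. Put [A i j = (4/9 p_ij(c^(n-3)) + 16/9 p_ij(c^n)) / sigma_j]. As
    [d_ij = p_ji], a step reads
    [z_i = rho_i + dt * sum_j (A_ij z_j - A_ji z_i)] with [z = c^(n+1)] and
    [rho = 11/27 c^(n-3) + 16/27 c^n]: an implicit exchange between components,
    with coefficients known before the step, and [A >= 0] when the previous
    concentrations are nonnegative. Summing over [i]
    gives [sum z = sum rho] ([exchange_total]), which is conservation. Taking
    absolute values before summing gives [sum |z| <= sum |rho|] for every
    [dt >= 0] ([exchange_norm1_le]). If [rho >= 0], the two together say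
    [sum |z| <= sum z], hence [z >= 0] ([exchange_ge0]), which is positivity.

    The difference between the exact solution and one step computed from exact
    data solves the same exchange system, with the residual of the exact
    solution as source. So the l^1 bound also turns a bound on the residual into
    one on the one-step error ([mpms_one_step_error]), and only the residual
    has to be estimated.

    With all the quotients [c_j^(n+1) / sigma_j] replaced by 1, the scheme is a
    linear two-point multistep method whose residual is [O(dt^4)] by Taylor
    expansion ([multistep_residual]). It remains to see that the quotients are
    [1 + O(dt^3)], since they are multiplied by [dt] and by bounded rates. The
    logarithm of [sigma_i] is a combination of the values of [ln c_i] at the
    last four levels; the relations between [s], [r] and [p] say exactly that
    this combination extrapolates quadratic polynomials correctly to the level
    [n + 1] ([extrapolation_residual]), so the quotient is the exponential of
    an [O(dt^3)] term ([sigma_ratio_error]). Uniformity in [n] comes from the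
    compactness of the time interval ([continuous_bounded]). *)

Set Implicit Arguments.
Unset Strict Implicit.
Unset Printing Implicit Defensive.

(** * Implicit exchange systems *)

Section Exchange.
Variables (R : realFieldType) (I : finType).
Implicit Types (A : I -> I -> R) (z rho : I -> R) (dt : R).

Lemma sum_exchange_eq0 A z :
  \sum_i \sum_j (A i j * z j - A j i * z i) = 0.
Proof.
under eq_bigr do rewrite sumrB.
by rewrite sumrB [X in _ - X]exchange_big subrr.
Qed.

Lemma exchange_total A z rho dt :
  (forall i, z i = rho i + dt * \sum_j (A i j * z j - A j i * z i)) ->
  \sum_i z i = \sum_i rho i.
Proof.
move=> zE; rewrite (eq_bigr _ (fun i _ => zE i)) big_split/=.
by rewrite -mulr_sumr sum_exchange_eq0 mulr0 addr0.
Qed.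

(** Moving the loss term of [z i] to the left makes its factor at least 1, so
    absolute values can be taken term by term. Summed over [i], the losses
    cancel the gains exactly as in [exchange_total]. No smallness of [dt] is
    involved: this is the discrete reason for unconditional stability. *)
Lemma exchange_norm1_le A z rho dt : 0 <= dt -> (forall i j, 0 <= A i j) ->
  (forall i, z i = rho i + dt * \sum_j (A i j * z j - A j i * z i)) ->
  \sum_i `|z i| <= \sum_i `|rho i|.
Proof.
move=> dt0 A0 zE.
suff : 0 <= \sum_i (`|rho i| - `|z i|
    + dt * \sum_j (A i j * `|z j| - A j i * `|z i|)).
  rewrite big_split/= -mulr_sumr (sum_exchange_eq0 A (fun i => `|z i|)).
  by rewrite mulr0 addr0 sumrB subr_ge0.
apply: sumr_ge0 => i _.
set out := \sum_j A j i.
have out0 : 0 <= out by apply: sumr_ge0.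
have zE' : (1 + dt * out) * z i = rho i + dt * \sum_j A i j * z j.
  have := zE i; rewrite sumrB -mulr_suml -/out; lra.
have -> : \sum_j (A i j * `|z j| - A j i * `|z i|)
    = \sum_j `|A i j * z j| - out * `|z i|.
  rewrite sumrB -mulr_suml; congr (_ - _).
  by apply: eq_bigr => j _; rewrite normrM ger0_norm.
have : `|(1 + dt * out) * z i| <= `|rho i| + dt * \sum_j `|A i j * z j|.
  rewrite zE'; apply: (le_trans (ler_normD _ _)); rewrite lerD2l.
  by rewrite normrM (ger0_norm dt0) ler_wpM2l// ler_norm_sum.
rewrite normrM ger0_norm; last by rewrite addr_ge0// mulr_ge0.
have regroup (a b S : R) :
    (1 + dt * out) * b <= a + dt * S -> 0 <= a - b + dt * (S - out * b) by lra.
exact: regroup.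
Qed.

(** The l^1 norm of [z] cannot exceed the total of [rho], which is the total of
    [z]; a negative entry would make it strictly larger. *)
Lemma exchange_ge0 A z rho dt : 0 <= dt -> (forall i j, 0 <= A i j) ->
  (forall i, z i = rho i + dt * \sum_j (A i j * z j - A j i * z i)) ->
  (forall i, 0 <= rho i) -> forall i, 0 <= z i.
Proof.
move=> dt0 A0 zE rho0.
have gap0 : \sum_i (`|z i| - z i) <= 0.
  rewrite sumrB (exchange_total zE) subr_le0.
  apply: (le_trans (exchange_norm1_le dt0 A0 zE)).
  by under eq_bigr do rewrite ger0_norm//.
have gapi i : 0 <= `|z i| - z i by rewrite subr_ge0 ler_norm.
move=> i; suff -> : z i = `|z i| by [].
apply/eqP; rewrite eq_sym -subr_eq0 eq_le gapi andbT.
apply: le_trans gap0.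
by rewrite (bigD1 i)//= lerDl sumr_ge0.
Qed.

End Exchange.

(** * The scheme as an exchange system *)

Section Scheme.
Variables (R : realType) (M : nat) (P D : 'I_M -> 'I_M -> 'cV[R]_M -> R).
Variables (s r p : R).
Hypothesis PD : production_destruction P D.
Implicit Types (y : nat -> 'cV[R]_M) (dt : R).

(** The coefficient with which [c_j^(n+1)] flows into component [i]. By
    [d_ij = p_ji] the loss coefficients are its transpose. *)
Definition transfer y (n : nat) (i j : 'I_M) : R :=
  (4 / 9 * P i j (y (n - 3)%N) + 16 / 9 * P i j (y n)) / sigma s r p y n j.

Lemma mpms_rhsE dt y n i :
  mpms_rhs P D s r p dt y n i =
  (11 / 27 * y (n - 3)%N i ord0 + 16 / 27 * y n i ord0)
  + dt * \sum_j (transfer y n i j * y n.+1 j ord0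
                 - transfer y n j i * y n.+1 i ord0).
Proof.
rewrite /mpms_rhs; congr (_ + dt * _); apply: eq_bigr => j _.
rewrite -!(PD.1 j i) /transfer; ring.
Qed.

Lemma sigma_ge0 y n i : 0 <= sigma s r p y n i.
Proof. by rewrite /sigma !mulr_ge0// powR_ge0. Qed.

Lemma transfer_ge0 y n i j : nneg_vec (y (n - 3)%N) -> nneg_vec (y n) ->
  0 <= transfer y n i j.
Proof.
move=> y3 y0; rewrite divr_ge0 ?sigma_ge0// addr_ge0// mulr_ge0//;
  exact: PD.2.
Qed.

Lemma mpms_total dt y n : mpms_step P D s r p dt y n ->
  Defs.total (y n.+1)
  = 11 / 27 * Defs.total (y (n - 3)%N) + 16 / 27 * Defs.total (y n).
Proof.
move=> step.
have stepE i := etrans (step i) (mpms_rhsE dt y n i).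
rewrite /Defs.total (exchange_total (z := fun i => y n.+1 i ord0) stepE).
by rewrite big_split/= -!mulr_sumr.
Qed.

Lemma mpms_conservative : conservative P D s r p.
Proof.
move=> dt y N _ [y01 y12 y23] step.
have tot m : (m <= N.+1)%N -> Defs.total (y m) = Defs.total (y 0%N).
  elim/ltn_ind: m => -[|[|[|[|m]]]] IH mN //.
  - by rewrite -y12.
  - by rewrite -y23 -y12.
  - rewrite (mpms_total (step m.+3 _)); last by lia.
    rewrite !IH//; [by field|lia|lia|lia].
by move=> n /andP[n3 nN]; split; rewrite !tot//; lia.
Qed.

Lemma mpms_positivity : positivity_preserving P D s r p.
Proof.
move=> dt y n dt0 n3 y0 step.
have y3 : nneg_vec (y (n - 3)%N) by apply: y0; lia.
have yn : nneg_vec (y n) by apply: y0; lia.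
apply: (exchange_ge0 (ltW dt0) _
  (fun i => etrans (step i) (mpms_rhsE dt y n i))) => [i j|i].
  exact: transfer_ge0.
by rewrite addr_ge0// mulr_ge0// ?y3 ?yn; lra.
Qed.

(** The errors solve the exchange system whose source is the residual of [e]:
    the coefficients depend only on the levels [n - 3, ..., n], on which [y]
    and [e] agree. *)
Lemma mpms_one_step_error dt (e y : nat -> 'cV[R]_M) n : 0 < dt -> (3 <= n)%N ->
  nneg_vec (e (n - 3)%N) -> nneg_vec (e n) ->
  (forall m, (n - 3 <= m <= n)%N -> y m = e m) ->
  mpms_step P D s r p dt y n ->
  forall i, `|e n.+1 i ord0 - y n.+1 i ord0|
    <= \sum_i `|e n.+1 i ord0 - mpms_rhs P D s r p dt e n i|.
Proof.
move=> dt0 n3 e3 en ye step i.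
have ye3 : y (n - 3)%N = e (n - 3)%N by apply: ye; lia.
have yen : y n = e n by apply: ye; lia.
have eqs : sigma s r p y n = sigma s r p e n.
  by apply/funext => k; rewrite /sigma !ye//; lia.
have eqA : transfer y n = transfer e n.
  by apply/funext => j; apply/funext => k; rewrite /transfer eqs ye3 yen.
pose z k := e n.+1 k ord0 - y n.+1 k ord0.
have zE k : z k = (e n.+1 k ord0 - mpms_rhs P D s r p dt e n k)
    + dt * \sum_j (transfer e n k j * z j - transfer e n j k * z k).
  rewrite /z [in LHS](step k) !mpms_rhsE eqA ye3 yen.
  have -> : \sum_j (transfer e n k j * z j - transfer e n j k * z k) =
    \sum_j (transfer e n k j * e n.+1 j ord0
            - transfer e n j k * e n.+1 k ord0)
    - \sum_j (transfer e n k j * y n.+1 j ord0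
            - transfer e n j k * y n.+1 k ord0).
    by rewrite -sumrB; apply: eq_bigr => j _; rewrite /z; ring.
  ring.
apply: le_trans (exchange_norm1_le (ltW dt0) _ zE); last first.
  by move=> *; exact: transfer_ge0.
by rewrite (bigD1 i)//= lerDl sumr_ge0.
Qed.

End Scheme.

(** * Taylor expansion on an interval *)

Section Analysis.
Variable R : realType.
Implicit Types (f g : R -> R) (F : nat -> R -> R) (a b t x y h K : R).

Lemma continuous_bounded a b f :
  (forall t, a <= t <= b -> {for t, continuous f}) ->
  exists K, forall t, a <= t <= b -> `|f t| <= K.
Proof.
move=> fc; have [ab|ba] := leP a b; last first.
  by exists 0 => t /andP[at_ tb]; lra.
have fn : {within `[a, b], continuous (fun t => `|f t|)}.
  apply: continuous_in_subspaceT => t; rewrite inE/= in_itv/= => tab.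
  by apply: cvg_norm; exact: fc.
have [c _ cmax] := EVT_max ab fn.
by exists `|f c| => t tab; apply: cmax; rewrite in_itv.
Qed.

Lemma finite_uniform_bound (I : finType) a b (f : I -> R -> R) :
  (forall i, exists K, forall t, a <= t <= b -> `|f i t| <= K) ->
  exists2 K, 0 <= K & forall i t, a <= t <= b -> `|f i t| <= K.
Proof.
move=> /choice[K fK]; exists (\sum_i `|K i|); first exact: sumr_ge0.
move=> i t tab; apply: (le_trans (fK i t tab)).
by rewrite (bigD1 i)//= (le_trans (ler_norm _))// lerDl sumr_ge0.
Qed.

(** No order is assumed between [x] and [y]: the expansions below look both
    forward and backward in time. *)
Lemma mean_value a b f g :
  (forall t, a <= t <= b -> is_derive t (1 : R) f (g t)) ->
  forall x y, a <= x <= b -> a <= y <= b ->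
  exists2 z, a <= z <= b /\ `|z - x| <= `|y - x| & f y - f x = g z * (y - x).
Proof.
move=> fg.
have main u v : a <= u -> u <= v -> v <= b ->
    exists2 z, u <= z <= v & f v - f u = g z * (v - u).
  move=> au uv vb.
  have [||z] := @MVT_segment R f g u v uv.
  - by move=> t; rewrite in_itv/= => /andP[? ?]; apply: fg; lra.
  - apply: derivable_within_continuous => t; rewrite in_itv/= => /andP[? ?].
    have tab : a <= t <= b by lra.
    by case: (fg t tab).
  by rewrite in_itv/=; exists z.
move=> x y /andP[ax xb] /andP[ay yb]; have [xy|/ltW yx] := leP x y.
  have [z /andP[xz zy] E] := main x y ax xy yb; exists z => //.
  split; first lra.
  by rewrite !ger0_norm; lra.
have [z /andP[yz zx] E] := main y x ay yx xb; exists z; last lra.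
by split; [lra|rewrite !ler0_norm; lra].
Qed.

Definition taylor F (m : nat) x y : R :=
  \sum_(k < m) F k x * ((y - x) ^+ k / k`!%:R).

(** The derivatives are carried as an explicit family, so that the same
    expansion serves iterated derivatives and closed formulas such as those of
    a logarithm. *)
Definition derivatives_on a b (m : nat) F :=
  forall k t, (k < m)%N -> a <= t <= b -> is_derive t (1 : R) (F k) (F k.+1 t).

Lemma is_derive_taylor F m x y :
  is_derive y (1 : R) (taylor F m.+1 x) (taylor (F \o S) m x y).
Proof.
(* The predecessor of 0 is 0, but that term has the factor k = 0. *)
have dterm (k : nat) : is_derive y (1 : R)
    (fun u => F k x * ((u - x) ^+ k / k`!%:R))
    (F k x * (k%:R * (y - x) ^+ k.-1 / k`!%:R)).
  have -> : (fun u => F k x * ((u - x) ^+ k / k`!%:R)) =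
      (F k x / k`!%:R) \*: ((id - cst x) ^+ k).
    by apply/funext => u /=; rewrite /GRing.scale/= fctE; ring.
  apply: is_derive_eq; rewrite /GRing.scale/= subr0 fctE; ring.
have := is_derive_sum (fun k : 'I_m.+1 => dterm k).
have -> : \sum_(k < m.+1) (fun u => F k x * ((u - x) ^+ k / k`!%:R))
    = taylor F m.+1 x.
  by apply/funext => u; rewrite fct_sumE.
move=> /is_derive_eq; apply.
rewrite big_ord_recl mul0r mul0r mulr0 add0r; apply: eq_bigr => k _ /=.
congr (_ * _); rewrite factS natrM -mulf_div divff ?mul1r//.
by rewrite pnatr_eq0.
Qed.

(** By induction on the order: the remainder of [F] vanishes at [x] and its
    derivative is the remainder of the shifted family. Bounding with the mean
    value theorem instead of integrating loses the factor [1 / m!], which does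
    not affect the order. *)
Lemma taylor_bound a b K F m :
  derivatives_on a b m F -> (forall t, a <= t <= b -> `|F m t| <= K) ->
  forall x y, a <= x <= b -> a <= y <= b ->
  `|F 0%N y - taylor F m x y| <= K * `|y - x| ^+ m.
Proof.
elim: m F => [|m IH] F dF FK x y xab yab.
  by rewrite /taylor big_ord0 subr0 expr0 mulr1; exact: FK.
have dF' : derivatives_on a b m (F \o S) by move=> k t km; exact: dF.
have dR t : a <= t <= b -> is_derive t (1 : R)
    (F 0%N - taylor F m.+1 x) ((F \o S) 0%N t - taylor (F \o S) m x t).
  move=> tab; apply: is_deriveB; first exact: dF.
  exact: is_derive_taylor.
have [z [zab zx] E] := mean_value dR xab yab.
have Rx : F 0%N x - taylor F m.+1 x x = 0.
  rewrite /taylor big_ord_recl big1 => [|k _]; last first.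
    by rewrite subrr expr0n/= mul0r mulr0.
  by rewrite expr0 fact0 divr1 mulr1 addr0 subrr.
have -> : F 0%N y - taylor F m.+1 x y = (F 0%N - taylor F m.+1 x) y by [].
rewrite -[X in `|X|]subr0 -[in X in _ - X]Rx [X in `|X|]E.
rewrite normrM exprSr mulrA ler_wpM2r//.
apply: (le_trans (IH _ dF' FK x z xab zab)).
rewrite ler_wpM2l ?lerXn2r ?nnegrE//.
exact: le_trans (FK x xab).
Qed.

Lemma norm_expR_sub1_le x : `|x| <= 1 / 2 -> `|expR x - 1| <= 2 * `|x|.
Proof.
move=> x2; have lo := expR_ge1Dx x; have hi := expR_ge1Dx (- x).
have e0 := expR_gt0 x.
have hi' : (1 - x) * expR x <= 1.
  by rewrite -[leRHS](expRxMexpNx_1 x) mulrC ler_pM2l.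
have [x0|x0] := leP 0 x.
  rewrite !ger0_norm; [|lra|lra]; rewrite ger0_norm in x2; [nra|lra].
have [e1|e1] := leP 1 (expR x).
  rewrite ger0_norm ?ltr0_norm; nra.
by rewrite !ltr0_norm; lra.
Qed.

End Analysis.

(** * Order conditions *)

Section Order.
Variable R : realType.
Implicit Types (F g : nat -> R -> R) (a b t h K : R).

(** Expanding about [t], the nodes [1] and [-3] with the given weights cancel
    all terms up to degree 3. The remainders contribute
    [1 + 11/27 * 3^4 + 4/9 * 3^3 = 46] times [K h^4]. *)
Lemma multistep_residual a b K F t h :
  derivatives_on a b 4 F -> (forall t, a <= t <= b -> `|F 4 t| <= K) ->
  0 < h -> a <= t - 3 * h -> t + h <= b ->
  `|F 0%N (t + h) - (11 / 27 * F 0%N (t - 3 * h) + 16 / 27 * F 0%N t)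
    - h * (4 / 9 * F 1%N (t - 3 * h) + 16 / 9 * F 1%N t)| <= 46 * K * h ^+ 4.
Proof.
move=> dF FK h0 at3 tb.
have tab : a <= t <= b by lra.
have t1ab : a <= t + h <= b by lra.
have t3ab : a <= t - 3 * h <= b by lra.
have dF' : derivatives_on a b 3 (F \o S) by move=> k u k3; exact: dF.
have := taylor_bound dF FK tab t1ab.
have := taylor_bound dF FK tab t3ab.
have := taylor_bound dF' FK tab t3ab.
rewrite /taylor !big_ord_recr !big_ord0 /= !factS fact0 !muln1 !natrM.
have -> : t + h - t = h by ring.
have -> : t - 3 * h - t = - (3 * h) by ring.
have h3 : 0 <= 3 * h by lra.
rewrite normrN (ger0_norm h3) (ger0_norm (ltW h0)).
rewrite !ler_norml => /andP[A1 A2] /andP[B1 B2] /andP[C1 C2].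
have {}A1 := ler_wpM2l (ltW h0) A1; have {}A2 := ler_wpM2l (ltW h0) A2.
apply/andP; split; lra.
Qed.

(** The four weights sum to 1, and the two relations between [s], [r] and [p]
    are the remaining conditions for extrapolating polynomials of degree at
    most 2 from the nodes [0, -1, -2, -3] to the node [1]. *)
Lemma extrapolation_residual a b K F t h (s r p : R) :
  r = - 3 * s + 6 -> p = 3 * s - 8 ->
  derivatives_on a b 3 F -> (forall t, a <= t <= b -> `|F 3 t| <= K) ->
  0 < h -> a <= t - 3 * h -> t + h <= b ->
  `|F 0%N (t + h) - (s * F 0%N t + r * F 0%N (t - h) + p * F 0%N (t - 2 * h)
       + (1 - r - s - p) * F 0%N (t - 3 * h))|
  <= (1 + `|r| + 8 * `|p| + 27 * `|1 - r - s - p|) * K * h ^+ 3.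
Proof.
move=> hr hp dF FK h0 at3 tb.
have tab : a <= t <= b by lra.
have K0 : 0 <= K by apply: le_trans (FK _ tab).
pose remainder (x : R) := F 0%N (t + x * h)
  - (F 0%N t + F 1%N t * (x * h) + F 2%N t * ((x * h) ^+ 2 / 2)).
have bound (x : R) : - 3 <= x <= 1 ->
    `|remainder x| <= `|x| ^+ 3 * (K * h ^+ 3).
  move=> x1; have xab : a <= t + x * h <= b by nra.
  have := taylor_bound dF FK tab xab.
  rewrite /taylor !big_ord_recr !big_ord0 /= !factS fact0 !muln1.
  have -> : t + x * h - t = x * h by ring.
  rewrite [X in `|X| <= _ -> _](_ : _ = remainder x).
    by rewrite normrM (ger0_norm (ltW h0)) exprMn mulrCA.
  by rewrite /remainder; field.
rewrite [X in `|X|](_ : _ = remainder 1 - (r * remainder (- 1)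
  + p * remainder (- 2) + (1 - r - s - p) * remainder (- 3))); last first.
  have e1 : t + 1 * h = t + h by ring.
  have e2 : t + - 1 * h = t - h by ring.
  have e3 : t + - 2 * h = t - 2 * h by ring.
  have e4 : t + - 3 * h = t - 3 * h by ring.
  by rewrite /remainder e1 e2 e3 e4 hr hp; field.
have weighted (w x : R) : - 3 <= x <= 1 ->
    `|w * remainder x| <= `|w| * (`|x| ^+ 3 * (K * h ^+ 3)).
  by move=> x1; rewrite normrM ler_wpM2l// bound.
have b1 : `|remainder 1| <= `|1| ^+ 3 * (K * h ^+ 3) by apply: bound; lra.
have b2 : `|r * remainder (- 1)| <= `|r| * (`|- 1| ^+ 3 * (K * h ^+ 3)).
  by apply: weighted; lra.
have b3 : `|p * remainder (- 2)| <= `|p| * (`|- 2| ^+ 3 * (K * h ^+ 3)).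
  by apply: weighted; lra.
have b4 : `|(1 - r - s - p) * remainder (- 3)|
    <= `|1 - r - s - p| * (`|- 3| ^+ 3 * (K * h ^+ 3)).
  by apply: weighted; lra.
apply: (le_trans (ler_normB _ _)).
apply: (le_trans (lerD b1 (le_trans (ler_normD _ _) (lerD _ b4)))).
  by apply: (le_trans (ler_normD _ _)); exact: lerD b2 b3.
rewrite !normrN normr1 !normr_nat le_eqVlt; apply/orP; left; apply/eqP; ring.
Qed.

(** For [g k] the [k]-th derivative of [g 0], these are [ln (g 0)] and its
    first three derivatives. *)
Definition log_derivatives g (k : nat) : R -> R :=
  match k with
  | 0 => fun t => ln (g 0%N t)
  | 1 => fun t => g 1%N t / g 0%N t
  | 2 => fun t => g 2%N t / g 0%N t - (g 1%N t / g 0%N t) ^+ 2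
  | _ => fun t => g 3%N t / g 0%N t
      - 3 * (g 1%N t / g 0%N t) * (g 2%N t / g 0%N t)
      + 2 * (g 1%N t / g 0%N t) ^+ 3
  end.

Lemma log_derivativesP a b g :
  derivatives_on a b 3 g -> (forall t, a <= t <= b -> 0 < g 0%N t) ->
  derivatives_on a b 3 (log_derivatives g).
Proof.
move=> dg g0 k t k3 tab.
have g0t := g0 _ tab; have g0t' := lt0r_neq0 g0t.
have d0 := dg 0%N t isT tab.
have d1 := dg 1%N t isT tab; have d2 := dg 2%N t isT tab.
have dV := is_deriveV g0t' d0.
case: k k3 => [|[|[|//]]] _ /=.
- have dl := is_derive1_ln g0t.
  by apply: is_derive_eq (is_derive1_comp dl d0) _; rewrite mulrC.
- apply: is_derive_eq (is_deriveM d1 dV) _.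
  by rewrite /GRing.scale/=; field.
- apply: is_derive_eq
    (is_deriveB (is_deriveM d2 dV) (is_deriveX 2 (is_deriveM d1 dV))) _.
  by rewrite /GRing.scale/= fctE; field.
Qed.

Lemma continuous_log_derivative3 g t : g 0%N t != 0 ->
  (forall k, (k < 4)%N -> {for t, continuous (g k)}) ->
  {for t, continuous (log_derivatives g 3)}.
Proof.
move=> g0 gc.
have q k : (k < 4)%N -> {for t, continuous (fun t => g k t / g 0%N t)}.
  by move=> k4; apply: cvgM; [exact: gc|apply: cvgV => //; exact: gc].
apply: cvgD; first apply: cvgB; first exact: q.
- by apply: cvgM; [apply: cvgM; [exact: cvg_cst|exact: q]|exact: q].
- apply: cvgM; first exact: cvg_cst.
  exact: continuous_comp (q 1%N isT) (@exprn_continuous R 3 _).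
Qed.

Lemma continuous_cV (M : nat) (c : R -> 'cV[R]_M) t :
  (forall i, {for t, continuous (fun u => c u i ord0)}) ->
  {for t, continuous c}.
Proof.
move=> cc A [B nB BA]; rewrite /nbhs/=.
have : \forall u \near t, forall i, B i ord0 (c u i ord0).
  apply: (@filter_forall R _ (fun i u => B i ord0 (c u i ord0)) (nbhs t)) => i.
  exact: (cc i _ (nB i ord0)).
by apply: filterS => u Bu; apply: BA => i j; rewrite (ord1 j).
Qed.

End Order.

(** * Accuracy along an exact solution *)

Section Accuracy.
Variables (R : realType) (M : nat) (P D : 'I_M -> 'I_M -> 'cV[R]_M -> R).
Variables (s r p : R).
Hypotheses (PD : production_destruction P D).
Hypotheses (hr : r = - 3 * s + 6) (hp : p = 3 * s - 8).

Lemma sigma_expR (y : nat -> 'cV[R]_M) n i :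
  (forall m, (n - 3 <= m <= n)%N -> 0 < y m i ord0) ->
  sigma s r p y n i = expR (s * ln (y n i ord0) + r * ln (y (n - 1)%N i ord0)
    + p * ln (y (n - 2)%N i ord0) + (1 - r - s - p) * ln (y (n - 3)%N i ord0)).
Proof.
move=> y0; rewrite /sigma !expRD /powR.
by rewrite !gt_eqF//; apply: y0; lia.
Qed.

Lemma on_gridB (c : R -> 'cV[R]_M) t0 dt (n k : nat) : (k <= n)%N ->
  on_grid c t0 dt (n - k) = c (t0 + n%:R * dt - k%:R * dt).
Proof. by move=> kn; rewrite /on_grid natrB// mulrBl addrA. Qed.

Lemma on_gridS (c : R -> 'cV[R]_M) t0 dt (n : nat) :
  on_grid c t0 dt n.+1 = c (t0 + n%:R * dt + dt).
Proof. by rewrite /on_grid -natr1 mulrDl mul1r addrA. Qed.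

Section Trajectory.
Variables (t0 T : R) (c : R -> 'cV[R]_M).
Hypothesis sol : exact_solution P D t0 T c.
Hypothesis Pc : forall i j x, pos_vec x -> {for x, continuous (P i j)}.

Let F (i : 'I_M) (k : nat) : R -> R := derive1n k (fun t => c t i ord0).

Lemma trajectory_derivatives i : derivatives_on t0 T 4 (F i).
Proof.
case: sol => -[a [b [at0 Tb c4]]] _ _ k t k4 /andP[t0t tT].
have tab : `]a, b[%classic t by rewrite /= in_itv/=; lra.
have [/(_ k k4) dk _] := c4 i t tab.
rewrite /F derive1nS derive1E; exact: derivableP.
Qed.

Lemma trajectory_continuous i k t : (k <= 4)%N -> t0 <= t <= T ->
  {for t, continuous (F i k)}.
Proof.
move=> k4 tT; have [k4'|] := ltnP k 4.
  have [dk _] := trajectory_derivatives i k4' tT.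
  by apply: differentiable_continuous; apply/derivable1_diffP.
move=> k4'; have -> : k = 4%N by lia.
case: sol => -[a [b [at0 Tb c4]]] _ _.
have tab : `]a, b[%classic t by rewrite /= in_itv/=; lra.
by have [] := c4 i t tab.
Qed.

Lemma trajectory_velocity i t : t0 <= t <= T ->
  F i 1 t = \sum_j P i j (c t) - \sum_j D i j (c t).
Proof.
move=> tT; case: sol => _ _ /(_ t tT i) dc.
by rewrite /F derive1n1 derive1E; apply: derive_val.
Qed.

Lemma trajectory_gt0 i t : t0 <= t <= T -> 0 < c t i ord0.
Proof. by case: sol => _ + _ => /(_ t) h /h. Qed.

Lemma trajectory_bound4 :
  exists2 K, 0 <= K & forall i t, t0 <= t <= T -> `|F i 4 t| <= K.
Proof.
apply: finite_uniform_bound => i; apply: continuous_bounded => t.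
exact: trajectory_continuous.
Qed.

Lemma log_trajectory_bound3 : exists2 K, 0 <= K &
  forall i t, t0 <= t <= T -> `|log_derivatives (F i) 3 t| <= K.
Proof.
apply: finite_uniform_bound => i; apply: continuous_bounded => t tT.
apply: continuous_log_derivative3.
  exact: lt0r_neq0 (trajectory_gt0 i tT).
by move=> k k4; apply: trajectory_continuous => //; exact: ltnW.
Qed.

Lemma rates_bound : exists2 K, 0 <= K &
  forall i j t, t0 <= t <= T -> `|P i j (c t)| <= K.
Proof.
have [K K0 bK] : exists2 K, 0 <= K & forall ij t, t0 <= t <= T ->
    `|P ij.1 ij.2 (c t)| <= K.
  apply: finite_uniform_bound => ij; apply: continuous_bounded => t tT.
  apply: (@continuous_comp _ _ _ c (P ij.1 ij.2)).
    by apply: continuous_cV => i; exact: (@trajectory_continuous i 0).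
  by apply: Pc => i; exact: trajectory_gt0.
by exists K => // i j; exact: (bK (i, j)).
Qed.

Lemma on_grid_gt0 dt (n m : nat) i : 0 < dt -> t0 + n%:R * dt <= T ->
  (m <= n)%N -> 0 < on_grid c t0 dt m i ord0.
Proof.
move=> dt0 nT mn; apply: trajectory_gt0.
have : m%:R * dt <= n%:R * dt by rewrite ler_pM2r// ler_nat.
have : 0 <= m%:R * dt by rewrite mulr_ge0// ltW.
lra.
Qed.

(** The condition on [dt] keeps the exponent below [1 / 2], where the
    exponential is at distance at most twice its argument from 1. *)
Lemma sigma_ratio_error : exists2 C, 0 <= C &
  forall dt n i, 0 < dt -> (3 <= n)%N -> t0 + n.+1%:R * dt <= T ->
  C * dt ^+ 3 <= 1 ->
  `|on_grid c t0 dt n.+1 i ord0 / sigma s r p (on_grid c t0 dt) n i - 1|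
    <= C * dt ^+ 3.
Proof.
have [K K0 bK] := log_trajectory_bound3.
pose C := (1 + `|r| + 8 * `|p| + 27 * `|1 - r - s - p|) * K.
have C0 : 0 <= C by rewrite !mulr_ge0// !addr_ge0// mulr_ge0.
exists (2 * C) => [|dt n i dt0 n3 nT C1]; first by rewrite mulr_ge0.
have e0 m : (m <= n.+1)%N -> 0 < on_grid c t0 dt m i ord0.
  exact: on_grid_gt0.
rewrite sigma_expR => [|m mn]; last by apply: e0; lia.
rewrite -[X in X / _]lnK ?posrE ?e0// -expRB.
set t := t0 + n%:R * dt.
have tT : t + dt <= T by move: nT; rewrite -natr1 mulrDl mul1r addrA.
have t3 : t0 <= t - 3 * dt.
  have : 3 * dt <= n%:R * dt by rewrite ler_pM2r// ler_nat.
  by rewrite /t; lra.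
have dL := log_derivativesP
  (fun k u k3 => @trajectory_derivatives i k u (ltnW k3))
  (fun u uT => trajectory_gt0 i uT).
have := extrapolation_residual hr hp dL (bK i) dt0 t3 tT.
rewrite /= /F /= -/C.
rewrite on_gridS !on_gridB//; [|lia|lia].
rewrite /on_grid -/t mul1r => dC.
apply: (le_trans (norm_expR_sub1_le _)).
  by apply: (le_trans dC); lra.
by rewrite -mulrA ler_pM2l.
Qed.

(** The residual splits into that of the linear multistep method applied to the
    exact solution, where the sums of rates are exact time derivatives, and the
    effect of replacing the weights 1 by the quotients [w j]. *)
Lemma residual_bound : exists2 B, 0 <= B & \forall dt \near 0^'+,
  forall (n : nat) i, (3 <= n)%N -> t0 + n.+1%:R * dt <= T ->
  `|on_grid c t0 dt n.+1 i ord0 - mpms_rhs P D s r p dt (on_grid c t0 dt) n i|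
    <= B * dt ^+ 4.
Proof.
have [K K0 bK] := trajectory_bound4.
have [Kp Kp0 bP] := rates_bound.
have [C C0 bC] := sigma_ratio_error.
(* Per pair of components: two rates, each weighted by 4 / 9 + 16 / 9. *)
pose Q := (40 / 9 * Kp * C) *+ M.
exists (46 * K + Q) => [|].
  by rewrite addr_ge0 ?mulrn_wge0 ?mulr_ge0//; lra.
near=> dt => n i n3 nT.
have dt0 : 0 < dt by near: dt; exact: nbhs_right_gt.
have dt1 : dt <= 1 by near: dt; apply: nbhs_right_le.
have dtC : dt <= (C + 1)^-1.
  by near: dt; apply: nbhs_right_le; rewrite invr_gt0; lra.
have Cdt : C * dt ^+ 3 <= 1.
  have dtC' : dt * (C + 1) <= 1 by rewrite -ler_pdivlMr ?div1r//; lra.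
  have : dt ^+ 3 <= dt by rewrite -[leRHS]expr1 ler_wiXn2l// ltW.
  nra.
set e := on_grid c t0 dt.
set t := t0 + n%:R * dt.
have tT : t + dt <= T by move: nT; rewrite -natr1 mulrDl mul1r addrA.
have t3 : t0 <= t - 3 * dt.
  have : 3 * dt <= n%:R * dt by rewrite ler_pM2r// ler_nat.
  by rewrite /t; lra.
have tab : t0 <= t <= T by lra.
have t3ab : t0 <= t - 3 * dt <= T by lra.
have taylor4 := multistep_residual (@trajectory_derivatives i) (bK i) dt0 t3 tT.
pose w j := e n.+1 j ord0 / sigma s r p e n j.
have wC j : `|w j - 1| <= C * dt ^+ 3 by exact: bC.
pose a j := 4 / 9 * P i j (c (t - 3 * dt)) + 16 / 9 * P i j (c t).
pose d j := 4 / 9 * D i j (c (t - 3 * dt)) + 16 / 9 * D i j (c t).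
have aK j : `|a j| <= 20 / 9 * Kp.
  have := bP i j _ tab; have := bP i j _ t3ab; rewrite /a !ler_norml; lra.
have dK j : `|d j| <= 20 / 9 * Kp.
  rewrite /d -!(PD.1 j i).
  have := bP j i _ tab; have := bP j i _ t3ab; rewrite !ler_norml; lra.
have patankar : `|\sum_j (a j * (w j - 1) - d j * (w i - 1))| <= Q * dt ^+ 3.
  apply: (le_trans (ler_norm_sum _ _ _)).
  have -> : Q * dt ^+ 3 = \sum_(j < M) 40 / 9 * Kp * C * dt ^+ 3.
    by rewrite sumr_const card_ord -mulrnAl.
  apply: ler_sum => j _; apply: (le_trans (ler_normB _ _)).
  rewrite !normrM.
  have := ler_pM (normr_ge0 _) (normr_ge0 _) (aK j) (wC j).
  have := ler_pM (normr_ge0 _) (normr_ge0 _) (dK j) (wC i).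
  lra.
rewrite [X in `|X|](_ : _ =
   (F i 0 (t + dt) - (11 / 27 * F i 0 (t - 3 * dt) + 16 / 27 * F i 0 t)
     - dt * (4 / 9 * F i 1 (t - 3 * dt) + 16 / 9 * F i 1 t))
   - dt * \sum_j (a j * (w j - 1) - d j * (w i - 1))).
  apply: (le_trans (ler_normB _ _)); rewrite [leRHS]mulrDl lerD//.
  rewrite normrM (ger0_norm (ltW dt0)) exprS mulrCA.
  by rewrite ler_pM2l.
have eS : e n.+1 = c (t + dt) by exact: on_gridS.
have e3 : e (n - 3)%N = c (t - 3 * dt) by exact: on_gridB.
have rhsE : mpms_rhs P D s r p dt e n i =
    11 / 27 * c (t - 3 * dt) i ord0 + 16 / 27 * c t i ord0
    + dt * \sum_j (a j * w j - d j * w i).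
  by rewrite /mpms_rhs e3.
rewrite rhsE eS !trajectory_velocity//.
rewrite /F /=.
have -> : \sum_j (a j * (w j - 1) - d j * (w i - 1)) =
  \sum_j (a j * w j - d j * w i) - (\sum_j a j - \sum_j d j).
  by rewrite -!sumrB; apply: eq_bigr => j _; ring.
rewrite /a /d !big_split/= -!mulr_sumr; ring.
Unshelve. all: by end_near. Qed.

End Trajectory.

Lemma mpms_third_order :
  (forall i j x, pos_vec x -> {for x, continuous (P i j)}) ->
  third_order_accurate P D s r p.
Proof.
move=> Pc t0 T c sol.
have [B B0 nearB] := residual_bound sol Pc.
(* Each component is bounded by the sum over all M of them, as needed for
   the one-step error. *)
exists (B *+ M).
near=> dt => n n3 nT.
set e := on_grid c t0 dt.
have dt0 : 0 < dt by near: dt; exact: nbhs_right_gt.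
have res i : `|e n.+1 i ord0 - mpms_rhs P D s r p dt e n i| <= B * dt ^+ 4.
  by rewrite /e {e}; move: n i n3 nT; near: dt.
have sumres : \sum_i `|e n.+1 i ord0 - mpms_rhs P D s r p dt e n i|
    <= B *+ M * dt ^+ 4.
  have -> : B *+ M * dt ^+ 4 = \sum_(i < M) B * dt ^+ 4.
    by rewrite sumr_const card_ord -mulrnAl.
  by apply: ler_sum => i _; exact: res.
have e0 m : (m <= n.+1)%N -> nneg_vec (e m).
  by move=> mn i; exact: ltW (on_grid_gt0 sol _ dt0 nT mn).
split=> [i|y ye step i].
  by apply: le_trans sumres; rewrite (bigD1 i)//= lerDl sumr_ge0.
apply: le_trans sumres.
apply: mpms_one_step_error ye step i => //; apply: e0; lia.
Unshelve. all: by end_near. Qed.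

End Accuracy.

(** * The theorem *)

Theorem theorem2p4 (R : realType) (M : nat)
    (P D : 'I_M -> 'I_M -> 'cV[R]_M -> R) (s r p : R)
    (PD : production_destruction P D)
    (hr : r = - 3 * s + 6) (hp : p = 3 * s - 8) :
  [/\ ((forall i j x, pos_vec x -> {for x, continuous (P i j)}) ->
        third_order_accurate P D s r p),
      conservative P D s r p
    & positivity_preserving P D s r p].
Proof.
split.
- exact: mpms_third_order.
- exact: mpms_conservative.
- exact: mpms_positivity.
Qed.
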